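(* Let $E$ be an elliptic curve over $\mathbb{Q}$ such that $E[2]\subseteq E(\mathbb{Q})$ and $E$ has a rational cyclic subgroup of order $4$. Then $E$ has a model $y^2=x(x-b)(x-a^2b)$ with $a,b\in\mathbb{Q}^\times$, $a\ne 1$. For such a model, let $g(u)$ be the polynomial of degree $11$ $$\begin{aligned}g(u)={}&-4bu\bigl((a-1)^2u-a\bigr)\bigl(a^2(a^2-3a+4)u-(a^2+1)(a-1)\bigr)\\&\times\bigl(a(a^2-3a+4)u^2-2a(a-1)u+a+1\bigr)\\&\times\bigl(a(a+1)(a-1)^2(a^2-3a+4)u^2-2a(a-1)^2(a^2+1)u+(a^2+1)^2\bigr)\\&\times\bigl(a^2(a-1)^2(a^2-3a+4)^2u^4-4a^2(a-1)^3(a^2-3a+4)u^3\\&\qquad+2(a-1)^2(3a^4-6a^3+5a^2+2)u^2-4a(a-1)^2(a^2+1)u+(a^2+1)^2\bigr).\end{aligned}$$ Then $E_{g(u)}$ has rank at least $3$ over $\mathbb{Q}(u)$.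
   Context: A rational cyclic subgroup of order $4$ is a cyclic subgroup of $E(\overline{\mathbb{Q}})$ of order $4$ that is stable under $\mathrm{Gal}(\overline{\mathbb{Q}}/\mathbb{Q})$. For $D\in\mathbb{Q}(u)^\times$, $E_D$ denotes the quadratic twist $Dy^2=x(x-b)(x-a^2b)$ over $\mathbb{Q}(u)$. *)

(* Defs.v *)
From HB Require Import structures.
From mathcomp Require Import all_boot all_order all_algebra all_field.
From mathcomp Require Import ring.

Set Implicit Arguments.
Unset Strict Implicit.
Unset Printing Implicit Defensive.

Import GRing.Theory.
Local Open Scope ring_scope.

(* y^2 + a1 x y + a3 y = x^3 + a2 x^2 + a4 x + a6 *)
Record weierstrass (F : Type) :=
  Weierstrass { wa1 : F; wa2 : F; wa3 : F; wa4 : F; wa6 : F }.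

Definition map_weierstrass (F K : Type) (f : F -> K) (W : weierstrass F) :=
  Weierstrass (f (wa1 W)) (f (wa2 W)) (f (wa3 W)) (f (wa4 W)) (f (wa6 W)).

Inductive point (F : Type) := Infty | Affine (x y : F).
Arguments Infty {F}.

Definition map_point (F K : Type) (f : F -> K) (P : point F) : point K :=
  if P is Affine x y then Affine (f x) (f y) else Infty.

Section Curve.
Variable F : fieldType.
Implicit Types (W : weierstrass F) (P Q : point F).

Definition discriminant W : F :=
  let: Weierstrass a1 a2 a3 a4 a6 := W in
  let b2 := a1 ^+ 2 + 4%:R * a2 in
  let b4 := 2%:R * a4 + a1 * a3 in
  let b6 := a3 ^+ 2 + 4%:R * a6 in
  let b8 := a1 ^+ 2 * a6 + 4%:R * a2 * a6 - a1 * a3 * a4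
            + a2 * a3 ^+ 2 - a4 ^+ 2 in
  - b2 ^+ 2 * b8 - 8%:R * b4 ^+ 3 - 27%:R * b6 ^+ 2 + 9%:R * b2 * b4 * b6.

(* W' is obtained from W by the change of variables x = u^2 x' + r,
   y = u^3 y' + s u^2 x' + t, i.e. W and W' define isomorphic elliptic curves
   over F. *)
Definition isomorphic W W' : Prop :=
  let: Weierstrass a1 a2 a3 a4 a6 := W in
  exists u r s t : F, u != 0 /\
  [/\ u * wa1 W' = a1 + 2%:R * s,
      u ^+ 2 * wa2 W' = a2 - s * a1 + 3%:R * r - s ^+ 2,
      u ^+ 3 * wa3 W' = a3 + r * a1 + 2%:R * t,
      u ^+ 4 * wa4 W' = a4 - s * a3 + 2%:R * r * a2 - (t + r * s) * a1
                        + 3%:R * r ^+ 2 - 2%:R * s * t &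
      u ^+ 6 * wa6 W' = a6 + r * a4 + r ^+ 2 * a2 + r ^+ 3
                        - t * a3 - t ^+ 2 - r * t * a1].

(* The group law below is stated for the curve
     d y^2 + a1 x y + a3 y = x^3 + a2 x^2 + a4 x + a6,   d != 0.
   With d = 1 this is the Weierstrass curve itself; when a1 = a3 = 0 it is,
   for arbitrary d, its quadratic twist by d.  The operations are meaningful
   only on points satisfying [on_curve]. *)
Variables (d : F) (W : weierstrass F).

Definition on_curve P : bool :=
  if P is Affine x y then
    d * y ^+ 2 + wa1 W * x * y + wa3 W * y
      == x ^+ 3 + wa2 W * x ^+ 2 + wa4 W * x + wa6 W
  else true.

Definition oppp P : point F :=
  if P is Affine x y then Affine x (- y - (wa1 W * x + wa3 W) / d) else Infty.

(* Chord-tangent law; lam is the slope of the line through the two points. *)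
Definition addp P Q : point F :=
  match P, Q with
  | Infty, _ => Q
  | _, Infty => P
  | Affine x1 y1, Affine x2 y2 =>
      if (x1 == x2) && (y2 == - y1 - (wa1 W * x1 + wa3 W) / d) then Infty
      else
        let lam :=
          if x1 == x2 then
            (3%:R * x1 ^+ 2 + 2%:R * wa2 W * x1 + wa4 W - wa1 W * y1)
              / (2%:R * d * y1 + wa1 W * x1 + wa3 W)
          else (y2 - y1) / (x2 - x1) in
        let x3 := d * lam ^+ 2 + wa1 W * lam - wa2 W - x1 - x2 in
        oppp (Affine x3 (y1 + lam * (x3 - x1)))
  end.

Definition mulpn P (n : nat) : point F := iter n (addp P) Infty.

Definition mulpz P (m : int) : point F :=
  match m with
  | Posz n => mulpn P n
  | Negz n => oppp (mulpn P n.+1)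
  end.

Definition has_order P (n : nat) : Prop :=
  [/\ (0 < n)%N, mulpn P n = Infty &
      forall k : nat, (0 < k < n)%N -> mulpn P k <> Infty].

Definition cyclic_subgroup (n : nat) (C : point F -> Prop) : Prop :=
  exists P, [/\ on_curve P, has_order P n &
                forall Q, C Q <-> exists k : nat, Q = mulpn P k].

(* The group of points on the curve has r points linearly independent over
   the integers. *)
Definition rank_at_least (r : nat) : Prop :=
  exists P : 'I_r -> point F,
    (forall i, on_curve (P i)) /\
    forall m : 'I_r -> int,
      \big[addp/Infty]_(i < r) mulpz (P i) (m i) = Infty ->
      forall i, m i = 0.

End Curve.

(* algC is an algebraic closure of rat. *)
Definition over_Qbar (W : weierstrass rat) : weierstrass algC :=
  map_weierstrass ratr W.

Definition full_rational_2torsion (W : weierstrass rat) : Prop :=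
  forall P : point algC,
    on_curve 1 (over_Qbar W) P -> mulpn 1 (over_Qbar W) P 2 = Infty ->
    exists2 P0 : point rat, on_curve 1 W P0 & P = map_point ratr P0.

(* Every ring morphism algC -> algC fixes the rationals and is bijective
   (algC_autK, algC_invautK), so these are the elements of Gal(Qbar/Q). *)
Definition galois_stable (C : point algC -> Prop) : Prop :=
  forall (sigma : {rmorphism algC -> algC}) (Q : point algC),
    C Q -> C (map_point sigma Q).

Definition has_rational_cyclic_subgroup (W : weierstrass rat) (n : nat) :=
  exists C : point algC -> Prop,
    cyclic_subgroup 1 (over_Qbar W) n C /\ galois_stable C.

(* y^2 = x (x - b) (x - a^2 b), in expanded form. *)
Definition model (F : fieldType) (a b : F) : weierstrass F :=
  Weierstrass 0 (- (b + a ^+ 2 * b)) 0 (a ^+ 2 * b ^+ 2) 0.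

Lemma on_curve_model (F : fieldType) (d a b x y : F) :
  on_curve d (model a b) (Affine x y)
    = (d * y ^+ 2 == x * (x - b) * (x - a ^+ 2 * b)).
Proof. by rewrite /on_curve /=; congr (_ == _); ring. Qed.

(* The constant field embedding of Q into Q(u). *)
Definition Qu_const (c : rat) : {fraction {poly rat}} := tofrac c%:P.

Definition twist_poly (a b : rat) : {poly rat} :=
  let c := a ^+ 2 - 3%:R * a + 4%:R in
  (- 4%:R * b) *: 'X
  * ((a - 1) ^+ 2 *: 'X - a%:P)
  * ((a ^+ 2 * c) *: 'X - ((a ^+ 2 + 1) * (a - 1))%:P)
  * ((a * c) *: 'X^2 - (2%:R * a * (a - 1)) *: 'X + (a + 1)%:P)
  * ((a * (a + 1) * (a - 1) ^+ 2 * c) *: 'X^2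
     - (2%:R * a * (a - 1) ^+ 2 * (a ^+ 2 + 1)) *: 'X
     + ((a ^+ 2 + 1) ^+ 2)%:P)
  * ((a ^+ 2 * (a - 1) ^+ 2 * c ^+ 2) *: 'X^4
     - (4%:R * a ^+ 2 * (a - 1) ^+ 3 * c) *: 'X^3
     + (2%:R * (a - 1) ^+ 2
        * (3%:R * a ^+ 4 - 6%:R * a ^+ 3 + 5%:R * a ^+ 2 + 2%:R)) *: 'X^2
     - (4%:R * a * (a - 1) ^+ 2 * (a ^+ 2 + 1)) *: 'X
     + ((a ^+ 2 + 1) ^+ 2)%:P).

(* Main.v *)
From HB Require Import structures.
Require Import Defs.
From mathcomp Require Import all_boot all_order all_algebra all_field.
From mathcomp Require Import ring.

(* Existence of the model: write E as eta^2 = (x - e1)(x - e2)(x - e3).  If P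
   has order 4 then 2P is one of the points (e_i, 0), which says that
   (x(P) - e_i)^2 = (e_i - e_j)(e_i - e_k).  Galois conjugates of P are
   generators of <P>, that is P or -P, so x(P) is rational, and
   a = (x(P) - e_i) / (e_j - e_i), b = e_j - e_i give the model.

   Rank: let A be the product of the first three factors of g (without -4b), B
   of the next two, and R the quartic one.  In the pencil spanned by A and B,
     4A + B = (a+1) R,               4a^2 A + B = (a+1) S1^2,
     4A + a^2 B = (a+1) S2^2,        (a-1)^2 B - 16a A = (a+1) S3^2.
   Hence z = -B/(4A) and v = -4A/(a+1) satisfy
   g = b (a+1)^2 v^3 z (z-1) while v (z-a^2), v (a^2 z-1) and
   v ((a-1)^2 z+4a) are squares: bz and a^2 b z are abscissas of points of E_g,
   and (a-1)^2 (z-1) is the abscissa of a point on a 2-isogenous curve, whose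
   image is a third point.

   Independence: the pullback of the invariant differential,
   (x, y) |-> x'/y, is an additive map from E_g(Q(u)) to Q(u).  On the three
   points its values are proportional to 1/S1, 1/S2 and -2/S3, which are
   linearly independent over Q. *)

Set Implicit Arguments.
Unset Strict Implicit.
Unset Printing Implicit Defensive.

Import Order.TTheory GRing.Theory Num.Theory.
Local Open Scope ring_scope.

(** * The formal derivative extended to fractions of polynomials *)

(** The Leibniz rule on [p * d = n * q] ties the two derivatives together, so the quotient rule
    gives the same value for p/q and for n/d. *)
Lemma quotient_rule_eq (R : comNzRingType) (p q n d p' q' n' d' : R) :
  p * d = n * q -> p' * d + p * d' = n' * q + n * q' ->
  (p' * q - p * q') * d ^+ 2 = (n' * d - n * d') * q ^+ 2.
Proof.
move=> eq_pn eqD.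
transitivity ((p' * d + p * d') * (d * q) - (p * d) * (q' * d + d' * q)); first by ring.
by rewrite eqD eq_pn; ring.
Qed.

Section QuotientRule.
Variables (K : fieldType) (p q n d p' q' n' d' : K).
Hypotheses (nz_q : q != 0) (nz_d : d != 0).

Lemma quotient_rule_add :
  ((p' * d + p * d' + (n' * q + n * q')) * (q * d)
     - (p * d + n * q) * (q' * d + q * d')) / (q * d) ^+ 2
  = (p' * q - p * q') / q ^+ 2 + (n' * d - n * d') / d ^+ 2.
Proof. by field; rewrite nz_q nz_d. Qed.

Lemma quotient_rule_mul :
  ((p' * n + p * n') * (q * d) - (p * n) * (q' * d + q * d')) / (q * d) ^+ 2
  = (p' * q - p * q') / q ^+ 2 * (n / d) + p / q * ((n' * d - n * d') / d ^+ 2).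
Proof. by field; rewrite nz_q nz_d. Qed.

End QuotientRule.

Section FractionDerivation.
Variable F : idomainType.
Implicit Types (p q : {poly F}) (x y : {fraction {poly F}}).

Local Open Scope quotient_scope.

Lemma fraction_numden x : x = tofrac \n_(repr x) / tofrac \d_(repr x).
Proof.
set r := repr x; have nz_d : tofrac \d_r != 0 by rewrite tofrac_eq0 denom_ratioP.
apply: (mulIf nz_d); rewrite divfK // -[x in LHS]reprK -/r; unlock tofrac.
rewrite -[LHS]FracField.pi_mul; apply/eqmodP.
rewrite /= FracField.equivfE /FracField.mulf.
by rewrite !numden_Ratio ?mulr1 ?denom_ratioP ?oner_neq0 // mulrC.
Qed.

(** The quotient rule on the representative picked by [repr]; [fraction_derivE] shows that every
    other representation gives the same value. *)
Definition fraction_deriv x : {fraction {poly F}} :=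
  let n := \n_(repr x) in let d := \d_(repr x) in
  tofrac (n^`() * d - n * d^`()) / tofrac d ^+ 2.

Lemma fraction_derivE p q : q != 0 ->
  fraction_deriv (tofrac p / tofrac q)
    = tofrac (p^`() * q - p * q^`()) / tofrac q ^+ 2.
Proof.
move=> nz_q; rewrite /fraction_deriv; set x := tofrac p / tofrac q.
have := fraction_numden x; have := denom_ratioP (repr x).
move: (\n_(repr x)) (\d_(repr x)) => n d nz_d; rewrite {}/x => eq_pn.
have [fq fd] : tofrac q != 0 /\ tofrac d != 0 by rewrite !tofrac_eq0.
have eq_poly : p * d = n * q.
  have /eqP := eq_pn; rewrite (eqr_div _ _ fq fd) -(tofracM p d) -(tofracM n q) tofrac_eq.
  by move/eqP.
have eqD : p^`() * d + p * d^`() = n^`() * q + n * q^`().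
  by rewrite -!derivM eq_poly.
apply/esym/eqP; rewrite (eqr_div _ _ (expf_neq0 2 fq) (expf_neq0 2 fd)).
rewrite -!tofracXn -!tofracM tofrac_eq; apply/eqP.
exact: quotient_rule_eq.
Qed.

Lemma fraction_deriv_tofrac p : fraction_deriv (tofrac p) = tofrac p^`().
Proof.
have := @fraction_derivE p 1 (oner_neq0 _).
by rewrite tofrac1 expr1n !divr1 derivC mulr0 subr0 mulr1.
Qed.

Lemma fraction_derivD : {morph fraction_deriv : x y / x + y}.
Proof.
move=> x y; rewrite (fraction_numden x) (fraction_numden y).
have := denom_ratioP (repr x); have := denom_ratioP (repr y).
move: (\n_(repr x)) (\d_(repr x)) (\n_(repr y)) (\d_(repr y)) => p q n d nz_d nz_q.
have [fq fd] : tofrac q != 0 /\ tofrac d != 0 by rewrite !tofrac_eq0.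
have -> : tofrac p / tofrac q + tofrac n / tofrac d
  = tofrac (p * d + n * q) / tofrac (q * d).
  by rewrite (addf_div _ _ fq fd) tofracD !tofracM.
rewrite !fraction_derivE; [|exact: nz_d|exact: nz_q|exact: mulf_neq0]; rewrite derivD !derivM.
rewrite !(tofracD, tofracM, tofracN).
apply: (@quotient_rule_add ({fraction {poly F}}) (tofrac p) (tofrac q) (tofrac n) (tofrac d)
  (tofrac p^`()) (tofrac q^`()) (tofrac n^`()) (tofrac d^`()) fq fd).
Qed.

Lemma fraction_derivM x y :
  fraction_deriv (x * y) = fraction_deriv x * y + x * fraction_deriv y.
Proof.
rewrite (fraction_numden x) (fraction_numden y).
have := denom_ratioP (repr x); have := denom_ratioP (repr y).
move: (\n_(repr x)) (\d_(repr x)) (\n_(repr y)) (\d_(repr y)) => p q n d nz_d nz_q.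
have [fq fd] : tofrac q != 0 /\ tofrac d != 0 by rewrite !tofrac_eq0.
have -> : tofrac p / tofrac q * (tofrac n / tofrac d)
  = tofrac (p * n) / tofrac (q * d).
  by rewrite (mulf_div (tofrac p) (tofrac q) (tofrac n) (tofrac d)) !tofracM.
rewrite !fraction_derivE; [|exact: nz_d|exact: nz_q|exact: mulf_neq0]; rewrite !derivM.
rewrite !(tofracD, tofracM, tofracN).
apply: (@quotient_rule_mul ({fraction {poly F}}) (tofrac p) (tofrac q) (tofrac n) (tofrac d)
  (tofrac p^`()) (tofrac q^`()) (tofrac n^`()) (tofrac d^`()) fq fd).
Qed.

End FractionDerivation.

(** * Additivity of the invariant differential on a twisted cubic *)

Section InvariantDifferential.
Variables (K : fieldType) (D : K -> K).
Hypothesis DD : {morph D : x y / x + y}.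
Hypothesis DM : forall x y, D (x * y) = D x * y + x * D y.

Lemma der0 : D 0 = 0.
Proof. by apply: (addrI (D 0)); rewrite -DD !addr0. Qed.

Lemma derN x : D (- x) = - D x.
Proof. by apply: (addrI (D x)); rewrite -DD !subrr der0. Qed.

Lemma der1 : D 1 = 0.
Proof. by apply: (addrI (D 1)); rewrite -[in RHS](mulr1 1) DM mulr1 mul1r addr0. Qed.

Lemma derV x : D x^-1 = - D x / x ^+ 2.
Proof.
have [-> | nz_x] := eqVneq x 0; first by rewrite invr0 der0 oppr0 mul0r.
have: D (x * x^-1) = 0 by rewrite divff ?der1.
rewrite DM => /eqP; rewrite addrC addr_eq0 => /eqP eqD.
by apply: (mulfI nz_x); rewrite eqD; field.
Qed.

Lemma derX2 x : D (x ^+ 2) = 2%:R * x * D x.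
Proof. by rewrite expr2 DM; ring. Qed.

Lemma derX3 x : D (x ^+ 3) = 3%:R * x ^+ 2 * D x.
Proof. by rewrite exprS DM derX2; ring. Qed.

Definition derE := (DD, derN, DM, derV, derX2, derX3, der1, der0).

Hypothesis two_nz : 2%:R != 0 :> K.
Variables d a2 a4 a6 : K.
Hypotheses (d_nz : d != 0) (Da2 : D a2 = 0) (Da4 : D a4 = 0) (Da6 : D a6 = 0).
Let W := Weierstrass 0 a2 0 a4 a6.
Let df x := 3%:R * x ^+ 2 + 2%:R * a2 * x + a4.

(* The value at P of the differential dx/(sqrt d * y), scaled by sqrt d.  The
   second equation, equivalent to w * y = D x when y != 0, determines w when
   y = 0, so that additivity needs no case distinction at the 2-torsion. *)
Definition has_differential (P : point K) (w : K) : Prop :=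
  on_curve d W P /\
  if P is Affine x y
  then w * y = D x /\ w * df x = 2%:R * d * D y + D d * y
  else w = 0.

Lemma has_differential_affine x y :
  on_curve d W (Affine x y) -> y != 0 -> has_differential (Affine x y) (D x / y).
Proof.
move=> onP nz_y; split=> //; split; first by rewrite divfK.
move: onP => /= /eqP; rewrite !mul0r !addr0 => eqP.
have eqDP := congr1 D eqP; rewrite !derE Da2 Da4 Da6 in eqDP.
(* Multiplied by y, the second equation is the derivative of the curve equation. *)
apply: (mulIf nz_y); have -> : D x / y * df x * y = D x * df x.
  by rewrite mulrAC divfK.
transitivity (3%:R * x ^+ 2 * D x + (0 * x ^+ 2 + a2 * (2%:R * x * D x))
  + (0 * x + a4 * D x) + 0); first by rewrite /df; ring.
by rewrite -eqDP; ring.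
Qed.

Lemma has_differential_opp P w :
  has_differential P w -> has_differential (oppp d W P) (- w).
Proof.
case: P => [|x y] /= [onP]; first by move=> ->; rewrite oppr0.
case=> wy wf; split=> /=.
  by move: onP => /=; rewrite !mul0r !addr0 mul0r subr0 sqrrN.
rewrite !mul0r addr0 mul0r subr0 derN; split; first by rewrite mulrNN.
by rewrite mulNr wf; ring.
Qed.

Hypothesis separable : forall x, on_curve d W (Affine x 0) -> df x != 0.

(** A direct check in three cases: P + Q = O, tangent, chord. [separable] serves the first one when
    y = 0: there the second equation of [has_differential] reads w * df x = 0, which forces w =
    0. *)
Lemma has_differential_add P Q w1 w2 :
  has_differential P w1 -> has_differential Q w2 ->
  has_differential (addp d W P Q) (w1 + w2).
Proof.
case: P Q => [|x1 y1] [|x2 y2].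
- by move=> [_ /= ->] [_ ->]; rewrite addr0.
- by move=> [_ /= ->] ?; rewrite add0r.
- by move=> ? [_ /= ->]; rewrite addr0.
move=> [onP [wy1 wf1]] [onQ [wy2 wf2]].
have e1 : d * y1 ^+ 2 = x1 ^+ 3 + a2 * x1 ^+ 2 + a4 * x1 + a6.
  by move: (onP) => /= /eqP; rewrite !mul0r !addr0.
have e2 : d * y2 ^+ 2 = x2 ^+ 3 + a2 * x2 ^+ 2 + a4 * x2 + a6.
  by move: (onQ) => /= /eqP; rewrite !mul0r !addr0.
rewrite /addp; case: ifPn => [/andP[/eqP ex /eqP]|]; rewrite /= !mul0r !addr0 !mul0r subr0.
  move=> ey; subst x2 y2; split=> //=.
  have [y0 | nz_y] := eqVneq y1 0; last first.
    apply: (mulIf nz_y); rewrite mul0r mulrDl wy1.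
    by apply/eqP; rewrite addr_eq0 -mulrN -wy2.
  move: wf1 wf2 onP; rewrite y0 oppr0 der0 !mulr0 addr0.
  move=> /eqP w1f /eqP w2f /separable dfx.
  by move: w1f w2f; rewrite !mulf_eq0 (negPf dfx) !orbF => /eqP -> /eqP ->; rewrite addr0.
(* Solving for D y, and writing D x as w * y, removes the derivatives of the coordinates; identities
   between rational functions remain. *)
have Dy x y w : w * df x = 2%:R * d * D y + D d * y ->
   D y = (w * df x - D d * y) / (2%:R * d).
  by move=> ->; rewrite addrK mulrAC divff ?mul1r // mulf_neq0.
have {wf1} Dy1 := Dy _ _ _ wf1.
have {wf2} Dy2 := Dy _ _ _ wf2.
have [ex | nex] := eqVneq x1 x2.
  subst x2 => /= ney.
  have ey : y2 = y1.
    have: (y2 - y1) * (y2 + y1) = 0.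
      by apply: (mulfI d_nz); rewrite mulr0 -subr_sqr mulrBr e1 e2 subrr.
    by move=> /eqP; rewrite mulf_eq0 subr_eq0 addr_eq0 (negPf ney) orbF => /eqP.
  subst y2.
  have nz_y : y1 != 0.
    by apply: contraNneq ney => ->; rewrite oppr0.
  have ew : w2 = w1 by apply: (mulIf nz_y); rewrite wy1.
  subst w2.
  have nz_den : 2%:R * d * y1 != 0 by rewrite !mulf_neq0.
  have ea6 : a6 = d * y1 ^+ 2 - (x1 ^+ 3 + a2 * x1 ^+ 2 + a4 * x1) by rewrite e1; ring.
  split; first by rewrite /= ea6; apply/eqP; field; rewrite ?nz_y ?d_nz ?two_nz.
  split; rewrite !derE Da2 Da4 -!wy1 ?Dy1 /df; field; rewrite ?nz_y ?d_nz ?two_nz //.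
move=> _ /=.
have nz_dx : x2 - x1 != 0 by rewrite subr_eq0 eq_sym.
(* Two points with distinct abscissas determine [a4] and [a6]; substituting these values uses up
   both curve equations. *)
have ea4 : a4 = (d * y2 ^+ 2 - d * y1 ^+ 2 - (x2 ^+ 3 - x1 ^+ 3)
  - a2 * (x2 ^+ 2 - x1 ^+ 2)) / (x2 - x1).
  by rewrite e1 e2; field.
have ea6 : a6 = d * y1 ^+ 2 - (x1 ^+ 3 + a2 * x1 ^+ 2 + a4 * x1) by rewrite e1; ring.
split; first by rewrite /= ea6 ea4; apply/eqP; field.
split; rewrite !derE Da2 -!wy1 -!wy2 ?Dy1 ?Dy2 /df ?ea4; field; rewrite ?nz_dx ?d_nz ?two_nz //.
Qed.

Lemma has_differential_mulpz P w (m : int) :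
  has_differential P w -> has_differential (Defs.mulpz d W P m) (m%:~R * w).
Proof.
move=> hP.
have hn n : has_differential (mulpn d W P n) (n%:R * w).
  elim: n => [|n IHn]; first by split; rewrite ?mul0r.
  rewrite mulrS mulrDl mul1r; exact: has_differential_add.
case: m => n; first exact: hn.
rewrite NegzE rmorphN mulNr; apply: has_differential_opp; exact: hn.
Qed.

Lemma has_differential_sum r (P : 'I_r -> point K) (w : 'I_r -> K) (m : 'I_r -> int) :
  (forall i, has_differential (P i) (w i)) ->
  has_differential (\big[addp d W/Infty]_(i < r) Defs.mulpz d W (P i) (m i))
    (\sum_(i < r) (m i)%:~R * w i).
Proof.
move=> hP; elim/big_rec2: _ => [|i w' Q _ hQ]; first by split.
apply: has_differential_add => //; exact: has_differential_mulpz.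
Qed.

(** At [Infty] the only admissible differential is 0, so a relation between the points is also a
    relation between their differentials. *)
Lemma differentials_rank r (P : 'I_r -> point K) (w : 'I_r -> K) :
  (forall i, has_differential (P i) (w i)) ->
  (forall m : 'I_r -> int, \sum_(i < r) (m i)%:~R * w i = 0 -> forall i, m i = 0) ->
  rank_at_least d W r.
Proof.
move=> hP free_w; exists P; split=> [i|m sum0]; first by have [] := hP i.
apply: free_w; have := has_differential_sum m hP.
by rewrite sum0 => -[_ ->].
Qed.
End InvariantDifferential.

(** * Three points on the twist and their differentials *)

Section TwistPoints.
Variables (K : fieldType) (D : K -> K).
Hypothesis DD : {morph D : x y / x + y}.
Hypothesis DM : forall x y, D (x * y) = D x * y + x * D y.
Hypothesis two_nz : 2%:R != 0 :> K.
Variables a b v z s1 s2 s3 : K.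
Hypotheses (Da : D a = 0) (Db : D b = 0) (nz_Dz : D z != 0).
Hypotheses (nz_a : a != 0) (nz_b : b != 0) (a_neq1 : a - 1 != 0) (nz_k : a + 1 != 0).
Hypotheses (nz_v : v != 0) (eq_sq1 : s1 ^+ 2 = v * (z - a ^+ 2))
  (eq_sq2 : s2 ^+ 2 = v * (a ^+ 2 * z - 1))
  (eq_sq3 : s3 ^+ 2 = v * ((a - 1) ^+ 2 * z + 4%:R * a)).
Let d := b * (a + 1) ^+ 2 * v ^+ 3 * z * (z - 1).
(** [d] equals b z (z - 1) [kv2]^2 / v. An ordinate with denominator [kv2] therefore leaves b z (z -
    1) / v, and the v is absorbed by the square of [s1], [s2] or [s3]. *)
Let kv2 := (a + 1) * v ^+ 2.
Let kappa := kv2 * D z.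

Let four_nz : 4%:R != 0 :> K.
Proof. by rewrite (natrM _ 2 2) mulf_neq0. Qed.

Let eight_nz : 8%:R != 0 :> K.
Proof. by rewrite (natrM _ 2 4) mulf_neq0. Qed.

Let D_two : D 2%:R = 0. Proof. by rewrite (natrD _ 1 1) DD (der1 DM) addr0. Qed.
Let D_four : D 4%:R = 0. Proof. by rewrite (natrM _ 2 2) DM !D_two mul0r mulr0 addr0. Qed.

Let dE := (D_four, Da, Db, derE DD DM).

Let nz_kv2 : kv2 != 0.
Proof. by rewrite mulf_neq0 ?expf_neq0. Qed.

Let nz_kappa : kappa != 0. Proof. exact: mulf_neq0. Qed.

(** Since D z is nonzero, z differs from every constant. This is the source of the nonvanishing of
    [d], [s1], [s2] and [s3]. *)
Let z_nonconst t : D t = 0 -> z - t != 0.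
Proof.
move=> Dt; apply: contraNneq nz_Dz => /eqP; rewrite subr_eq0 => /eqP ->.
by rewrite Dt.
Qed.

Let z_eq0 : z != 0.
Proof. by have := z_nonconst (der0 DD); rewrite subr0. Qed.

Let twist_nz : d != 0.
Proof.
by rewrite !mulf_neq0 ?expf_neq0 // z_nonconst // (der1 DM).
Qed.

Let nz_s1 : s1 != 0.
Proof.
have: s1 ^+ 2 != 0.
  rewrite eq_sq1 mulf_neq0 ?nz_v //; apply: z_nonconst.
  by rewrite !dE mulr0.
by rewrite expf_eq0.
Qed.

Let nz_s2 : s2 != 0.
Proof.
have: s2 ^+ 2 != 0.
  have -> : s2 ^+ 2 = v * a ^+ 2 * (z - a ^- 2) by rewrite eq_sq2; field.
  apply: mulf_neq0; first by rewrite mulf_neq0 ?expf_neq0.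
  apply: z_nonconst.
  by rewrite !dE !mulr0 oppr0 mul0r.
by rewrite expf_eq0.
Qed.

Let nz_s3 : s3 != 0.
Proof.
have: s3 ^+ 2 != 0.
  have -> : s3 ^+ 2 = v * (a - 1) ^+ 2 * (z - - (4%:R * a) / (a - 1) ^+ 2).
    by rewrite eq_sq3; field.
  apply: mulf_neq0; first by rewrite mulf_neq0 ?expf_neq0.
  apply: z_nonconst.
  by rewrite !dE; ring.
by rewrite expf_eq0.
Qed.

(** As w + (a + 1)^2 = (a - 1)^2 z + 4a and w + (a - 1)^2 = (a - 1)^2 z, the point (w, y0) lies on d
    y^2 = b w (w + (a + 1)^2) (w + (a - 1)^2). *)
Let w := (a - 1) ^+ 2 * (z - 1).
Let y0 := (a - 1) ^+ 2 * s3 / kv2.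

(* The third point is the image of (w, y0) under an isogeny of degree 2. *)
Let twist_point (i : nat) : point K :=
  nth Infty [:: Affine (b * z) (b * s1 / kv2);
    Affine (b * a ^+ 2 * z) (b * a ^+ 2 * s2 / kv2);
    Affine (b * (w + (a + 1) ^+ 2) * (w + (a - 1) ^+ 2) / (4%:R * w))
      (b * y0 * ((a ^+ 2 - 1) ^+ 2 - w ^+ 2) / (8%:R * w ^+ 2))] i.

(** The point (w, y0) has D w / y0 = kappa / s3, and the isogeny multiplies it by -2. *)
Let twist_differential (i : nat) : K :=
  kappa * nth 0 [:: s1^-1; s2^-1; - 2%:R / s3] i.

Let model_differential x y omega :
  d * y ^+ 2 = x * (x - b) * (x - a ^+ 2 * b) -> y != 0 -> omega * y = D x ->
  has_differential D d (- (b + a ^+ 2 * b)) (a ^+ 2 * b ^+ 2) 0 (Affine x y) omega.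
Proof.
move=> onP nz_y eq_omega.
have -> : omega = D x / y by rewrite -eq_omega mulfK.
apply: has_differential_affine => //; try by rewrite !dE; ring.
by have := on_curve_model d a b x y; rewrite /model => ->; apply/eqP.
Qed.

Let twist_point_differential (i : 'I_3) :
  has_differential D d (- (b + a ^+ 2 * b)) (a ^+ 2 * b ^+ 2) 0
    (twist_point i) (twist_differential i).
Proof.
have Dw : D w = (a - 1) ^+ 2 * D z.
  by rewrite /w !dE; ring.
have Da2 : D (a ^+ 2 - 1) = 0 by rewrite !dE; ring.
have w_nonconst t : D t = 0 -> w - t != 0.
  move=> Dt; have : D w != 0 by rewrite Dw mulf_neq0 ?expf_neq0.
  by apply: contraNneq => /eqP; rewrite subr_eq0 => /eqP ->; rewrite Dt.
have nz_w : w != 0 by have := w_nonconst _ (der0 DD); rewrite subr0.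
have nz_y0 : y0 != 0 by rewrite !mulf_neq0 ?expf_neq0 ?invr_neq0 ?nz_s3.
have nz_diff : (a ^+ 2 - 1) ^+ 2 - w ^+ 2 != 0.
  rewrite -oppr_eq0 opprB subr_sqr mulf_neq0 ?w_nonconst //.
  by rewrite -[a ^+ 2 - 1]opprK w_nonconst // (derN DD) Da2 oppr0.
case: i => [[|[|[|//]]] lt_i]; rewrite /twist_point /twist_differential /=;
  apply: model_differential.
- have -> : d * (b * s1 / kv2) ^+ 2 = d * b ^+ 2 * s1 ^+ 2 / kv2 ^+ 2.
    by field; apply: nz_kv2.
  rewrite eq_sq1 /d /kv2; field; rewrite ?nz_v ?nz_k //.
- by rewrite !mulf_neq0 ?invr_neq0 ?nz_s1.
- by rewrite /kappa !dE; field; rewrite nz_s1 nz_kv2.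
- have -> : d * (b * a ^+ 2 * s2 / kv2) ^+ 2 = d * b ^+ 2 * a ^+ 4 * s2 ^+ 2 / kv2 ^+ 2.
    by field; apply: nz_kv2.
  rewrite eq_sq2 /d /kv2; field; rewrite ?nz_v ?nz_k //.
- by rewrite !mulf_neq0 ?invr_neq0 ?expf_neq0 ?nz_s2.
- by rewrite /kappa !dE; field; rewrite nz_s2 nz_kv2.
- have ey0 : d * y0 ^+ 2 = b * w * (w + (a + 1) ^+ 2) * (w + (a - 1) ^+ 2).
    transitivity (d * (a - 1) ^+ 4 * s3 ^+ 2 / kv2 ^+ 2).
      by rewrite /y0; field; apply: nz_kv2.
    by rewrite eq_sq3 /d /kv2 /w; field; rewrite ?nz_v ?nz_k.
  transitivity ((d * y0 ^+ 2) * b ^+ 2 * ((a ^+ 2 - 1) ^+ 2 - w ^+ 2) ^+ 2 / (8%:R * w ^+ 2) ^+ 2).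
    by field; rewrite nz_w eight_nz.
  by rewrite ey0; field; rewrite nz_w four_nz eight_nz.
- exact: mulf_neq0 (mulf_neq0 (mulf_neq0 nz_b nz_y0) nz_diff)
    (invr_neq0 (mulf_neq0 eight_nz (expf_neq0 2 nz_w))).
- rewrite !(Dw, dE) /kappa /y0; field.
  by rewrite nz_s3 nz_kv2 nz_w eight_nz four_nz.
Qed.

Let model_separable x :
  on_curve d (model a b) (Affine x 0) ->
  3%:R * x ^+ 2 + 2%:R * (- (b + a ^+ 2 * b)) * x + a ^+ 2 * b ^+ 2 != 0.
Proof.
have nz_a2 : a ^+ 2 - 1 != 0 by rewrite -[1](expr1n _ 2) subr_sqr mulf_neq0.
rewrite on_curve_model expr0n mulr0 eq_sym !mulf_eq0 !subr_eq0 => /orP[/orP[]|] /eqP ->.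
- have -> : 3%:R * 0 ^+ 2 + 2%:R * (- (b + a ^+ 2 * b)) * 0 + a ^+ 2 * b ^+ 2
    = (a * b) ^+ 2 by ring.
  by rewrite expf_neq0 ?mulf_neq0.
- have -> : 3%:R * b ^+ 2 + 2%:R * (- (b + a ^+ 2 * b)) * b + a ^+ 2 * b ^+ 2
    = - b ^+ 2 * (a ^+ 2 - 1) by ring.
  by rewrite mulf_neq0 ?oppr_eq0 ?expf_neq0.
- have -> : 3%:R * (a ^+ 2 * b) ^+ 2 + 2%:R * (- (b + a ^+ 2 * b)) * (a ^+ 2 * b)
    + a ^+ 2 * b ^+ 2 = (a * b) ^+ 2 * (a ^+ 2 - 1) by ring.
  by rewrite mulf_neq0 ?expf_neq0 ?mulf_neq0.
Qed.

(** The hypothesis is the independence of 1/s1, 1/s2 and -2/s3 over the integers, with the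
    denominator s1 s2 s3 cleared. *)
Lemma twist_rank3 :
  (forall m : 'I_3 -> int,
     (m 0)%:~R * (s2 * s3) + (m 1)%:~R * (s1 * s3)
       - 2%:R * (m 2)%:~R * (s1 * s2) = 0 -> forall i, m i = 0) ->
  rank_at_least d (model a b) 3.
Proof.
move=> free_s.
have D_a2 : D (- (b + a ^+ 2 * b)) = 0 by rewrite !dE; ring.
have D_a4 : D (a ^+ 2 * b ^+ 2) = 0 by rewrite !dE; ring.
apply: (differentials_rank DD DM two_nz twist_nz D_a2 D_a4
  model_separable twist_point_differential).
move=> m eq0; apply: free_s.
move: eq0; rewrite !big_ord_recl big_ord0 /twist_differential /=.
have -> : lift ord0 ord0 = 1 :> 'I_3 by apply: val_inj.
have -> : lift ord0 (lift ord0 ord0) = 2 :> 'I_3 by apply: val_inj.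
move=> eq0; apply: (mulfI nz_kappa); rewrite mulr0.
transitivity ((s1 * s2 * s3) * 0); last by rewrite mulr0.
rewrite -eq0; field.
by rewrite nz_s1 nz_s2 nz_s3.
Qed.
End TwistPoints.

(** [nonconst] is a Wronskian: for z = -B / (4A), dividing it by -4A^2 gives D z. *)
Lemma twist_rank3_quartics (K : fieldType) (D : K -> K)
    (DD : {morph D : x y / x + y})
    (DM : forall x y, D (x * y) = D x * y + x * D y)
    (two_nz : 2%:R != 0 :> K) (a b A B C s1 s2 s3 : K)
    (Da : D a = 0) (Db : D b = 0) (nz_a : a != 0) (nz_b : b != 0)
    (a_neq1 : a - 1 != 0) (nz_k : a + 1 != 0)
    (eqC : 4%:R * A + B = (a + 1) * C)
    (eq_s1 : 4%:R * a ^+ 2 * A + B = (a + 1) * s1 ^+ 2)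
    (eq_s2 : 4%:R * A + a ^+ 2 * B = (a + 1) * s2 ^+ 2)
    (eq_s3 : (a - 1) ^+ 2 * B - 16%:R * a * A = (a + 1) * s3 ^+ 2)
    (nz_A : A != 0) (nonconst : D B * A - B * D A != 0)
    (free_s : forall m : 'I_3 -> int,
     (m 0)%:~R * (s2 * s3) + (m 1)%:~R * (s1 * s3)
       - 2%:R * (m 2)%:~R * (s1 * s2) = 0 -> forall i, m i = 0) :
  rank_at_least (- 4%:R * b * A * B * C) (model a b) 3.
Proof.
have four_nz : 4%:R != 0 :> K by rewrite (natrM _ 2 2) mulf_neq0.
have D_two : D 2%:R = 0 by rewrite (natrD _ 1 1) DD (der1 DM) addr0.
have D_four : D 4%:R = 0 by rewrite (natrM _ 2 2) DM !D_two mul0r mulr0 addr0.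
pose z := - B / (4%:R * A); pose v := - 4%:R * A / (a + 1).
have eqB : B = - 4%:R * A * z by rewrite /z; field; rewrite nz_A four_nz.
have -> : - 4%:R * b * A * B * C = b * (a + 1) ^+ 2 * v ^+ 3 * z * (z - 1).
  have -> : C = (4%:R * A + B) / (a + 1) by rewrite eqC; field.
  by rewrite eqB /v; field.
have nz_Dz : D z != 0.
  have -> : D z = (D B * A - B * D A) / (- 4%:R * A ^+ 2).
    by rewrite /z !(D_four, derE DD DM); field; rewrite oppr_eq0 nz_A four_nz.
  by rewrite mulf_neq0 // invr_neq0 // mulf_neq0 ?oppr_eq0 ?expf_neq0.
apply: (twist_rank3 DD DM two_nz Da Db nz_Dz nz_a nz_b a_neq1 nz_k _ _ _ _ free_s).
- by rewrite !mulf_neq0 ?invr_neq0 ?oppr_eq0.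
- by apply: (mulfI nz_k); rewrite -eq_s1 eqB /v; field.
- by apply: (mulfI nz_k); rewrite -eq_s2 eqB /v; field.
- by apply: (mulfI nz_k); rewrite -eq_s3 eqB /v; field.
Qed.

(** * Passage from polynomials to rational functions *)

Lemma map_model (F K : fieldType) (f : {rmorphism F -> K}) (a b : F) :
  map_weierstrass f (model a b) = model (f a) (f b).
Proof. by congr Weierstrass; rewrite /=; ring. Qed.

(** [tofrac] is an injective morphism and [fraction_deriv] restricts to the formal derivative, so
    every hypothesis can be verified among polynomials. *)
Lemma twist_rank3_poly (a b : rat) (A B C S1 S2 S3 : {poly rat})
    (nz_a : a != 0) (nz_b : b != 0) (a_neq1 : a - 1 != 0) (nz_k : a + 1 != 0)
    (eqC : 4%:R * A + B = (a%:P + 1) * C)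
    (eq_s1 : 4%:R * a%:P ^+ 2 * A + B = (a%:P + 1) * S1 ^+ 2)
    (eq_s2 : 4%:R * A + a%:P ^+ 2 * B = (a%:P + 1) * S2 ^+ 2)
    (eq_s3 : (a%:P - 1) ^+ 2 * B - 16%:R * a%:P * A = (a%:P + 1) * S3 ^+ 2)
    (nz_A : A != 0) (nonconst : B^`() * A - B * A^`() != 0)
    (free_S : forall m : 'I_3 -> int,
     (m 0)%:~R * (S2 * S3) + (m 1)%:~R * (S1 * S3)
       - 2%:R * (m 2)%:~R * (S1 * S2) = 0 -> forall i, m i = 0) :
  rank_at_least (tofrac (- 4%:R * b%:P * A * B * C))
    (map_weierstrass Qu_const (model a b)) 3.
Proof.
pose f : {rmorphism {poly rat} -> {fraction {poly rat}}} := @tofrac {poly rat}.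
have f_inj p : (f p == 0) = (p == 0) by exact: tofrac_eq0.
have D_f p : fraction_deriv (f p) = f p^`() by exact: fraction_deriv_tofrac.
have two_nz : 2%:R != 0 :> {fraction {poly rat}}.
  by rewrite -(rmorph_nat f 2) f_inj -polyC_natr polyC_eq0.
have DD := @fraction_derivD rat; have DM := @fraction_derivM rat.
have E1 : f (- 4%:R * b%:P * A * B * C) = - 4%:R * f b%:P * f A * f B * f C.
  by rewrite !rmorphM rmorphN rmorph_nat.
have E2 : map_weierstrass Qu_const (model a b) = model (f a%:P) (f b%:P).
  pose g : {rmorphism rat -> {fraction {poly rat}}} := f \o polyC.
  exact: (map_model g a b).
rewrite E2 [tofrac _]E1.
have f1 : f 1 = 1 by exact: rmorph1.
have [F0 F1 F2 F3] : [/\ 4%:R * f A + f B = (f a%:P + 1) * f C,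
    4%:R * f a%:P ^+ 2 * f A + f B = (f a%:P + 1) * f S1 ^+ 2,
    4%:R * f A + f a%:P ^+ 2 * f B = (f a%:P + 1) * f S2 ^+ 2 &
    (f a%:P - 1) ^+ 2 * f B - 16%:R * f a%:P * f A = (f a%:P + 1) * f S3 ^+ 2].
  move: (a%:P) eqC eq_s1 eq_s2 eq_s3 => c e0 e1 e2 e3; split.
  - by rewrite -f1 -(rmorph_nat f 4) -!rmorphD -!rmorphM -rmorphD e0.
  - by rewrite -f1 -(rmorph_nat f 4) -!rmorphXn -!rmorphD -!rmorphM -rmorphD e1.
  - by rewrite -f1 -(rmorph_nat f 4) -!rmorphXn -!rmorphD -!rmorphM -rmorphD e2.
  - by rewrite -f1 -(rmorph_nat f 16) -rmorphB -!rmorphXn -!rmorphD -!rmorphM -rmorphB e3.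
apply: (twist_rank3_quartics DD DM two_nz (s1 := f S1) (s2 := f S2) (s3 := f S3)).
- by rewrite D_f derivC rmorph0.
- by rewrite D_f derivC rmorph0.
- by rewrite f_inj polyC_eq0.
- by rewrite f_inj polyC_eq0.
- by rewrite -f1 -rmorphB f_inj -polyC1 -polyCB polyC_eq0.
- by rewrite -f1 -rmorphD f_inj -polyC1 -polyCD polyC_eq0.
- exact: F0.
- exact: F1.
- exact: F2.
- exact: F3.
- by rewrite f_inj.
- by rewrite !D_f -!rmorphM -rmorphB f_inj.
- move=> m eq0; apply: free_S; apply/eqP; rewrite -f_inj -eq0; apply/eqP.
  by rewrite rmorphB rmorphD !rmorphM !rmorph_int rmorph_nat.
Qed.

(** * Galois action on an irrational square root *)

(** The minimal polynomial of w over Q divides X^2 - q and is not linear, so it is X^2 - q, which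
    also has the root -w. The resulting automorphism of Q(w) extends to [algC]. *)
Lemma aut_neg_sqrt (w : algC) (q : rat) :
  w ^+ 2 = ratr q -> (forall q0 : rat, w <> ratr q0) ->
  exists sigma : {rmorphism algC -> algC}, sigma w = - w.
Proof.
move=> w2 w_irr.
have [Qs [QsC [[|w0 []]// [Dw] gen]]] := num_field_exists [:: w].
rewrite adjoin_seq1 in gen.
have w02 : w0 ^+ 2 = q%:A.
  by apply: (fmorph_inj QsC); rewrite rmorphXn /= Dw w2 alg_num_field fmorph_rat.
have w0_irr : w0 \notin 1%VS.
  apply/negP=> /vlineP[q0 eq_w0]; apply: (w_irr q0).
  by rewrite -Dw eq_w0 alg_num_field fmorph_rat.
have rootN : root (minPoly 1 w0) (- w0).
  pose p : {poly Qs} := 'X^2 - (q%:A)%:P.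
  have p_monic : p \is monic by rewrite monicXnsubC.
  have dvd_p : minPoly 1 w0 %| p.
    apply: minPoly_dvdp; first by rewrite rpredB ?rpredX ?polyOverX ?polyOverC ?rpredZ ?mem1v.
    by rewrite /root !hornerE w02 subrr.
  have : minPoly 1 w0 %= p.
    rewrite -dvdp_size_eqp // size_XnsubC // size_minPoly.
    rewrite eqSS eqn_leq; apply/andP; split; last first.
      by rewrite ltn_neqAle eq_sym adjoin_deg_eq1 w0_irr; apply: ltn0Sn.
    rewrite -ltnS -size_minPoly (leq_trans (dvdp_leq (monic_neq0 p_monic) dvd_p)) //.
    by rewrite size_XnsubC.
  rewrite eqp_monic ?monic_minPoly // => /eqP ->.
  by rewrite /root !hornerE sqrrN w02 subrr.
pose f := kHomExtend 1 \1 w0 (- w0).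
have hom_f : kHom 1 <<1; w0>> f.
  by apply: kHomExtendP; rewrite ?kHom1 ?lfun1_poly.
have fw0 : f w0 = - w0 by rewrite (kHomExtend_val (kHom1 1 1)) ?lfun1_poly.
have hom_fL : kHom 1 {:Qs} f by rewrite -gen.
have [fM1 f1] := kHom_lrmorphism hom_fL.
have f_mul : GRing.monoid_morphism f by [].
pose fA := GRing.isZmodMorphism.Build Qs Qs f (raddfB f).
pose fM := GRing.isMonoidMorphism.Build Qs Qs f f_mul.
pose fR : {rmorphism Qs -> Qs} := HB.pack (f : Qs -> Qs) fA fM.
have [nu Dnu] := extend_algC_subfield_aut QsC fR.
exists nu.
by rewrite -Dw -(Dnu w0) /= fw0 rmorphN.
Qed.

(** * Discriminants and points of order 2 *)

Lemma isomorphic_discriminant (F : fieldType) (W W' : weierstrass F) :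
  isomorphic W W' -> exists2 u : F, u != 0 & discriminant W = u ^+ 12 * discriminant W'.
Proof.
case: W W' => [a1 a2 a3 a4 a6] [a1' a2' a3' a4' a6'] /=.
move=> [u [r [s [t [nz_u [/= e1 e2 e3 e4 e6]]]]]]; exists u => //.
have f1 : a1 = u * a1' - 2%:R * s by rewrite e1; ring.
have f2 : a2 = u ^+ 2 * a2' + s * a1 - 3%:R * r + s ^+ 2 by rewrite e2; ring.
have f3 : a3 = u ^+ 3 * a3' - r * a1 - 2%:R * t by rewrite e3; ring.
have f4 : a4 = u ^+ 4 * a4' + s * a3 - 2%:R * r * a2 + (t + r * s) * a1
            - 3%:R * r ^+ 2 + 2%:R * s * t by rewrite e4; ring.
have f6 : a6 = u ^+ 6 * a6' - r * a4 - r ^+ 2 * a2 - r ^+ 3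
            + t * a3 + t ^+ 2 + r * t * a1 by rewrite e6; ring.
rewrite f6 f4 f3 f2 f1; ring.
Qed.

Lemma model_discriminant (F : fieldType) (a b : F) :
  discriminant (model a b) = 16%:R * b ^+ 6 * a ^+ 4 * (a ^+ 2 - 1) ^+ 2.
Proof. rewrite /=; ring. Qed.

(* Its roots are the abscissas of the points of order 2. *)
Definition psi2 (F : fieldType) (W : weierstrass F) : {poly F} :=
  4%:R *: 'X^3 + (wa1 W ^+ 2 + 4%:R * wa2 W) *: 'X^2
   + (2%:R * (2%:R * wa4 W + wa1 W * wa3 W)) *: 'X + (wa3 W ^+ 2 + 4%:R * wa6 W)%:P.

Lemma horner_psi2 (F : fieldType) (W : weierstrass F) x :
  (psi2 W).[x] = 4%:R * x ^+ 3 + (wa1 W ^+ 2 + 4%:R * wa2 W) * x ^+ 2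
    + 2%:R * (2%:R * wa4 W + wa1 W * wa3 W) * x + (wa3 W ^+ 2 + 4%:R * wa6 W).
Proof. by rewrite /psi2 !(hornerD, hornerZ, hornerXn, hornerX, hornerC). Qed.

Section TwoTorsion.
Variables (F : fieldType) (W : weierstrass F).
Hypothesis two_nz : 2%:R != 0 :> F.

(** Four times the curve equation reads (2y + a1 x + a3)^2 = psi2(x); the chosen ordinate makes the
    left side 0, so the point is its own negative. *)
Lemma root_psi2_mulpn2 x :
  root (psi2 W) x ->
  let P := Affine x (- (wa1 W * x + wa3 W) / 2%:R) in
  on_curve 1 W P /\ mulpn 1 W P 2 = Infty.
Proof.
rewrite /root horner_psi2 => /eqP rt; split=> /=; last first.
  by rewrite eqxx divr1 /=; case: eqP => // -[]; field.
apply/eqP/(mulfI (mulf_neq0 two_nz two_nz)); apply/eqP; rewrite -subr_eq0.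
set lhs := (X in X == 0).
have -> : lhs = - (4%:R * x ^+ 3 + (wa1 W ^+ 2 + 4%:R * wa2 W) * x ^+ 2
  + 2%:R * (2%:R * wa4 W + wa1 W * wa3 W) * x + (wa3 W ^+ 2 + 4%:R * wa6 W)).
  by rewrite /lhs; field.
by rewrite rt oppr0.
Qed.
End TwoTorsion.

Lemma psi2_map (F K : fieldType) (f : {rmorphism F -> K}) (W : weierstrass F) :
  psi2 (map_weierstrass f W) = map_poly f (psi2 W).
Proof.
apply/polyP=> i; rewrite coef_map !coefE /=.
by case: (i == 0); ring.
Qed.

(* psi2 W = 4 ('X - e1)('X - e2)('X - e3), coefficientwise. *)
Definition factored (F : fieldType) (W : weierstrass F) (e1 e2 e3 : F) : Prop :=
  [/\ wa1 W ^+ 2 + 4%:R * wa2 W = - 4%:R * (e1 + e2 + e3),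
   2%:R * wa4 W + wa1 W * wa3 W = 2%:R * (e1 * e2 + e1 * e3 + e2 * e3) &
   wa3 W ^+ 2 + 4%:R * wa6 W = - 4%:R * (e1 * e2 * e3)].

Lemma factored_coefs (F : fieldType) (W : weierstrass F) e1 e2 e3 :
  2%:R != 0 :> F -> factored W e1 e2 e3 ->
  [/\ wa2 W = - (e1 + e2 + e3) - wa1 W ^+ 2 / 4%:R,
      wa4 W = e1 * e2 + e1 * e3 + e2 * e3 - wa1 W * wa3 W / 2%:R &
      wa6 W = - (e1 * e2 * e3) - wa3 W ^+ 2 / 4%:R].
Proof.
move=> two_nz [h2 h4 h6].
have four_nz : 4%:R != 0 :> F by rewrite (natrM _ 2 2) mulf_neq0.
split.
- by apply: (mulfI four_nz); apply: (addrI (wa1 W ^+ 2)); rewrite h2; field.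
- by apply: (mulfI two_nz); apply: (addIr (wa1 W * wa3 W)); rewrite h4; field.
- by apply: (mulfI four_nz); apply: (addrI (wa3 W ^+ 2)); rewrite h6; field.
Qed.

(** The roots of [psi2] over [algC] are abscissas of points of order 2, hence rational, and the
    factorisation descends to Q. *)
Lemma full_rational_2torsion_factored (W : weierstrass rat) :
  full_rational_2torsion W -> exists e1 e2 e3, factored W e1 e2 e3.
Proof.
move=> tors.
have rat_root (x : algC) : root (psi2 (over_Qbar W)) x -> exists e, x = ratr e.
  have two_nz : 2%:R != 0 :> algC by rewrite pnatr_eq0.
  move=> /(root_psi2_mulpn2 two_nz) [onP P2].
  by have [[|x0 y0] // _ [ex _]] := tors _ onP P2; exists x0.
have size_psi : size (psi2 (over_Qbar W)) = 4.
  rewrite /psi2 -!addrA size_polyDl ?size_scale ?size_polyXn ?pnatr_eq0 //.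
  rewrite ltnS (leq_trans (size_polyD _ _)) // geq_max.
  rewrite (leq_trans (size_scale_leq _ _)) ?size_polyXn //=.
  rewrite (leq_trans (size_polyD _ _)) // geq_max.
  rewrite (leq_trans (size_scale_leq _ _)) ?size_polyX //=.
  by rewrite (leq_trans (size_polyC_leq1 _)).
have lead_psi : lead_coef (psi2 (over_Qbar W)) = 4%:R.
  by rewrite lead_coefE size_psi /psi2 !coefE /= !mulr0 mulr1 !addr0.
have [rs] := closed_field_poly_normal (psi2 (over_Qbar W)).
rewrite lead_psi => eq_psi.
have size_rs : size rs = 3.
  have := congr1 (fun p => size (polyseq p)) eq_psi.
  by rewrite /= size_scale ?pnatr_eq0 // size_prod_XsubC size_psi => -[].
have rs_root x : x \in rs -> exists e, x = ratr e.
  move=> rs_x; apply: rat_root; rewrite eq_psi rootZ ?pnatr_eq0 //.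
  by rewrite root_prod_XsubC.
case: rs size_rs eq_psi rs_root => [|r1 [|r2 [|r3 [|//]]]] // _ eq_psi rs_root.
have [e1 E1] : exists e, r1 = ratr e by apply: rs_root; rewrite !inE eqxx.
have [e2 E2] : exists e, r2 = ratr e by apply: rs_root; rewrite !inE eqxx !orbT.
have [e3 E3] : exists e, r3 = ratr e by apply: rs_root; rewrite !inE eqxx !orbT.
have {}eq_psi : psi2 W = 4%:R *: (('X - e1%:P) * ('X - e2%:P) * ('X - e3%:P)).
  apply: (map_poly_inj (ratr : {rmorphism rat -> algC})).
  rewrite -psi2_map [LHS]eq_psi !big_cons big_nil mulr1 map_polyZ !rmorphM /=.
  by rewrite !map_polyXsubC E1 E2 E3 (rmorph_nat _ 4) mulrA.
exists e1, e2, e3; rewrite /factored.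
have horner_psi x : 4%:R * x ^+ 3 + (wa1 W ^+ 2 + 4%:R * wa2 W) * x ^+ 2
   + (2%:R * (2%:R * wa4 W + wa1 W * wa3 W)) * x + (wa3 W ^+ 2 + 4%:R * wa6 W)
   = 4%:R * ((x - e1) * (x - e2) * (x - e3)).
  by have := congr1 (fun p => p.[x]) eq_psi; rewrite horner_psi2 => ->; rewrite !hornerE.
(* Both sides are cubics with leading coefficient 4, so the values at 0, 1 and -1 determine the
   other three coefficients. *)
have h0 := horner_psi 0; have h1 := horner_psi 1; have h2 := horner_psi (-1).
move: h0 h1 h2; move: (_ ^+ 2 + _) (_ + wa1 W * _) (_ + _ * wa6 W) => b2 b4 b6.
move=> h0 h1 h2.
have hb6 : b6 = - 4%:R * (e1 * e2 * e3).
  by transitivity (4%:R * ((0 - e1) * (0 - e2) * (0 - e3))); [rewrite -h0|]; ring.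
split=> //.
  apply: (mulfI (_ : 2%:R != 0 :> rat)) => //.
  transitivity (4%:R * ((1 - e1) * (1 - e2) * (1 - e3))
   + 4%:R * ((-1 - e1) * (-1 - e2) * (-1 - e3)) - 2%:R * b6).
    by rewrite -h1 -h2; ring.
  by rewrite hb6; ring.
apply: (mulfI (_ : 4%:R != 0 :> rat)) => //.
transitivity (4%:R * ((1 - e1) * (1 - e2) * (1 - e3))
   - 4%:R * ((-1 - e1) * (-1 - e2) * (-1 - e3)) - 8%:R).
  by rewrite -h1 -h2; ring.
by ring.
Qed.

(** * Points of order 4 and the rationality of their abscissas *)

Section OrderFour.
Variables (F : fieldType) (W : weierstrass F).
Hypothesis two_nz : 2%:R != 0 :> F.

(** Uses only the addition formulas, not associativity: P + 3P = O gives 3P = -P, and comparing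
    slopes then shows that 2P is its own negative. *)
Lemma order4_multiples (P : point F) :
  has_order 1 W P 4 ->
  exists x y x2 y2,
    [/\ P = Affine x y, 2%:R * y + wa1 W * x + wa3 W != 0,
        addp 1 W P P = Affine x2 y2, 2%:R * y2 + wa1 W * x2 + wa3 W = 0 &
        addp 1 W P (Affine x2 y2) = oppp 1 W P].
Proof.
case=> _ P4 Pk.
have P1 : P <> Infty by move=> P0; apply: (Pk 1%N) => //; rewrite P0.
have P2 : addp 1 W P P <> Infty by have := Pk 2%N isT; rewrite /mulpn /=; case: (P).
have P3 : addp 1 W P (addp 1 W P P) <> Infty.
  by have := Pk 3%N isT; rewrite /mulpn /=; case: (P).
have {}P4 : addp 1 W P (addp 1 W P (addp 1 W P P)) = Infty.
  by move: P4; rewrite /mulpn /=; case: (P).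
case: P P1 P2 P3 P4 {Pk} => // x y _.
have addPP : addp 1 W (Affine x y) (Affine x y) <> Infty ->
   2%:R * y + wa1 W * x + wa3 W != 0.
  move=> nz; apply/eqP=> eta0; apply: nz; rewrite /= eqxx /= divr1.
  suff -> : y == - y - (wa1 W * x + wa3 W) by [].
  by rewrite -subr_eq0; apply/eqP; rewrite -[RHS]eta0; ring.
move=> P2; have eta_nz := addPP P2.
set lam := (3%:R * x ^+ 2 + 2%:R * wa2 W * x + wa4 W - wa1 W * y)
  / (2%:R * y + wa1 W * x + wa3 W).
set x2 := lam ^+ 2 + wa1 W * lam - wa2 W - x - x.
set y2 := - (y + lam * (x2 - x)) - (wa1 W * x2 + wa3 W).
have eqP2 : addp 1 W (Affine x y) (Affine x y) = Affine x2 y2.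
  move: P2; rewrite /= eqxx /= !divr1 !mulr1 !mul1r.
  by case: ifP.
rewrite eqP2 => P3 P4; exists x, y, x2, y2.
suff [eta2 ->] : 2%:R * y2 + wa1 W * x2 + wa3 W = 0 /\
   addp 1 W (Affine x y) (Affine x2 y2) = oppp 1 W (Affine x y) by [].
move: P3 P4; rewrite {2 3 4}/addp; case: ifPn => // ninv.
rewrite /= !divr1 !mul1r !mulr1 => _.
case: ifPn => // /andP[/eqP]; move: ninv; rewrite /= divr1.
(* If 2P had the abscissa of P, the formula for P + 2P would be that for P + P; then 4P = O would
   make 2P the negative of P, against 3P <> O. *)
have [ex | nex] := eqVneq x x2.
  rewrite -ex -/lam -/x2 => /= ninv ex3 /eqP ey3; case/eqP: ninv.
  by rewrite -ey3 -/x2 /y2 -ex; ring.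
move=> _; set mu := (y2 - y) / (x2 - x); move=> ex3 ey3.
have nz_dx : x2 - x != 0 by rewrite subr_eq0 eq_sym.
have ymu : y2 = y + mu * (x2 - x) by rewrite /mu divfK // addrC subrK.
split; last first.
  by rewrite -ex3; congr Affine; ring.
(* [lam] is the tangent slope at P and [mu] the slope of the chord through P and 2P. If they agree,
   2P lies on the tangent at P and so equals -2P; the other root would make P its own negative. *)
have : (mu - lam) * (mu + lam + wa1 W) = 0.
  transitivity ((mu ^+ 2 + wa1 W * mu - wa2 W - x - x2) - x).
    by rewrite /x2; ring.
  by rewrite -ex3 subrr.
move/eqP; rewrite mulf_eq0 => /orP[|] /eqP eq_mu.
  have elam : mu = lam by rewrite -[mu](subrK lam) eq_mu add0r.
  transitivity (y2 + (y + lam * (x2 - x)) + (wa1 W * x2 + wa3 W)).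
    by rewrite -elam -ymu; ring.
  by rewrite /y2; ring.
case/eqP: eta_nz.
transitivity (y2 - (y + mu * (x2 - x)) + (2%:R * y + wa1 W * x + wa3 W)).
  by rewrite -ymu subrr add0r.
have -> : mu = - (lam + wa1 W) by rewrite -[LHS](addrK (lam + wa1 W)) addrA eq_mu add0r.
by rewrite /y2; ring.
Qed.

(** Twice the product is the division polynomial of 4 divided by that of 2. It arises from the
    vanishing of 2y + a1 x + a3 at 2P: times -eta^3 this is a polynomial in x and eta^2, and eta^2 =
    4 (x - e1)(x - e2)(x - e3). *)
Lemma order4_x (e1 e2 e3 : F) P :
  factored W e1 e2 e3 -> on_curve 1 W P -> has_order 1 W P 4 ->
  exists x y, P = Affine x y /\
    ((x - e1) ^+ 2 - (e1 - e2) * (e1 - e3)) * ((x - e2) ^+ 2 - (e2 - e1) * (e2 - e3))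
      * ((x - e3) ^+ 2 - (e3 - e1) * (e3 - e2)) = 0.
Proof.
move=> fac onP /order4_multiples[x [y [x2 [y2 [eP eta_nz eP2 eta2 _]]]]].
exists x, y; split=> //; subst P.
set eta := 2%:R * y + wa1 W * x + wa3 W in eta_nz.
have four_nz : 4%:R != 0 :> F by rewrite (natrM _ 2 2) mulf_neq0.
have [a2E a4E a6E] := factored_coefs two_nz fac.
have yE : y = (eta - wa1 W * x - wa3 W) / 2%:R by rewrite /eta; field.
have eta_sq : eta ^+ 2 = 4%:R * ((x - e1) * (x - e2) * (x - e3)).
  move/eqP: onP; rewrite /= a2E a4E a6E yE => onP.
  transitivity (4%:R * (1 * ((eta - wa1 W * x - wa3 W) / 2%:R) ^+ 2 +
     wa1 W * x * ((eta - wa1 W * x - wa3 W) / 2%:R) +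
     wa3 W * ((eta - wa1 W * x - wa3 W) / 2%:R)) + (wa1 W * x + wa3 W) ^+ 2).
    by field.
  by rewrite onP; field; rewrite two_nz four_nz.
pose f' := (x - e1) * (x - e2) + (x - e1) * (x - e3) + (x - e2) * (x - e3).
move: eP2 eta2; rewrite /= eqxx /= !divr1 !mulr1 !mul1r.
case: ifP => // _ [<- <-] eq0.
have key : eta ^+ 4 + 2%:R * f' * (f' ^+ 2 + eta ^+ 2 * (e1 + e2 + e3 - 3%:R * x)) = 0.
  transitivity (- eta ^+ 3 * 0); last by rewrite mulr0.
  rewrite -[in RHS]eq0 -/eta a2E a4E yE /f'; field.
  by rewrite eta_nz four_nz two_nz.
rewrite (_ : eta ^+ 4 = eta ^+ 2 * eta ^+ 2) in key; last by ring.
rewrite eta_sq /f' in key.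
apply: (mulfI two_nz); rewrite mulr0 -[RHS]oppr0 -key; ring.
Qed.
End OrderFour.

Lemma rational_order4_x (W : weierstrass rat) (C : point algC -> Prop) x y :
  galois_stable C ->
  (forall Q, C Q <-> exists k, Q = mulpn 1 (over_Qbar W) (Affine x y) k) ->
  has_order 1 (over_Qbar W) (Affine x y) 4 ->
  forall sigma : {rmorphism algC -> algC}, sigma x = x.
Proof.
move=> stabC genC ord4 sigma.
have two_nz : 2%:R != 0 :> algC by rewrite pnatr_eq0.
have [x' [y' [x2 [y2 [[<- <-] eta_nz eP2 eta2 eP3]]]]] := order4_multiples ord4.
have ord4_4 : mulpn 1 (over_Qbar W) (Affine x y) 4 = Infty by case: ord4.
set P := Affine x y in genC ord4_4 eP2 eP3 *.
have mults k : let Q := mulpn 1 (over_Qbar W) P k in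
  [\/ Q = Infty, Q = P, Q = Affine x2 y2 | Q = oppp 1 (over_Qbar W) P].
  elim: k => [|k IHk] /=; first by constructor 1.
  rewrite -/(mulpn 1 (over_Qbar W) P k).
  case: IHk => ->; [constructor 2 | constructor 3 | constructor 4 | constructor 1] => //.
  by rewrite -eP3 -eP2.
have CP : C P by apply/genC; exists 1%N.
have /genC[k eQ] := stabC sigma P CP.
move: (mults k); rewrite /= -eQ /= => -[] // [] // ex ey.
(* The remaining case is sigma P = 2P. It is impossible because sigma fixes the coefficients and so
   preserves the nonvanishing of 2y + a1 x + a3. *)
case/eqP: eta_nz; apply: (fmorph_inj sigma); rewrite rmorph0 -eta2 -ex -ey.
have sa1 : sigma (wa1 (over_Qbar W)) = wa1 (over_Qbar W) by exact: fmorph_rat.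
have sa3 : sigma (wa3 (over_Qbar W)) = wa3 (over_Qbar W) by exact: fmorph_rat.
by rewrite -[in RHS]sa1 -[in RHS]sa3; ring.
Qed.

(** * Existence of the model *)

Lemma factored_discriminant (F : fieldType) (W : weierstrass F) e1 e2 e3 :
  2%:R != 0 :> F -> factored W e1 e2 e3 ->
  discriminant W = 16%:R * ((e1 - e2) * (e1 - e3) * (e2 - e3)) ^+ 2.
Proof.
move=> two_nz /(factored_coefs two_nz)[].
case: W => a1 a2 a3 a4 a6 /= -> -> ->; field.
by rewrite two_nz (natrM _ 2 2) mulf_neq0.
Qed.

(** With b = e2 - e1 and a = q / b one has a^2 b = e3 - e1, so moving e1 to 0 sends the three roots
    to 0, b and a^2 b; a = 1 would mean e2 = e3. *)
Lemma factored_model (F : fieldType) (W : weierstrass F) e1 e2 e3 q :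
  2%:R != 0 :> F -> factored W e1 e2 e3 -> discriminant W != 0 ->
  q ^+ 2 = (e1 - e2) * (e1 - e3) ->
  exists a b, [/\ a != 0, b != 0, a != 1 & isomorphic W (model a b)].
Proof.
move=> two_nz fac; rewrite (factored_discriminant two_nz fac) => disc q2.
have [n12 n13 n23] : [/\ e1 - e2 != 0, e1 - e3 != 0 & e2 - e3 != 0].
  by move: disc; rewrite mulf_eq0 expf_eq0 !mulf_eq0 /= !negb_or => /and3P[_ /andP[]].
have four_nz : 4%:R != 0 :> F by rewrite (natrM _ 2 2) mulf_neq0.
have nb : e2 - e1 != 0 by rewrite -oppr_eq0 opprB.
have q_nz : q != 0.
  by apply: contraTneq (mulf_neq0 n12 n13) => q0; rewrite -q2 q0 expr0n eqxx.
have aab : (q / (e2 - e1)) ^+ 2 * (e2 - e1) = e3 - e1.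
  by rewrite expr_div_n q2; field.
exists (q / (e2 - e1)), (e2 - e1); split=> //.
- by rewrite mulf_neq0 ?invr_neq0.
- apply: contraNneq n23 => a1; move: aab; rewrite a1 expr1n mul1r => /addIr ->.
  by rewrite subrr.
have [ea2 ea4 ea6] := factored_coefs two_nz fac.
move: ea2 ea4 ea6; case: (W) => a1 a2 a3 a4 a6 /= -> -> ->.
(* The translation by e1 moves this root to 0, and s and t complete the square in y. *)
exists 1, e1, (- a1 / 2%:R), (- (a3 + e1 * a1) / 2%:R); split; first exact: oner_neq0.
have -> : (q / (e2 - e1)) ^+ 2 * (e2 - e1) ^+ 2 = (e3 - e1) * (e2 - e1).
  by rewrite -aab; ring.
rewrite /= aab; split; field; rewrite ?two_nz ?four_nz //.
Qed.

Lemma exists_model (E : weierstrass rat) :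
  discriminant E != 0 -> full_rational_2torsion E ->
  has_rational_cyclic_subgroup E 4 ->
  exists a b : rat, [/\ a != 0, b != 0, a != 1 & isomorphic E (model a b)].
Proof.
move=> disc /full_rational_2torsion_factored[e1 [e2 [e3 fac]]].
case=> C [[P [onP ord4 genC]] stabC].
have two_nz : 2%:R != 0 :> algC by rewrite pnatr_eq0.
have facC : factored (over_Qbar E) (ratr e1) (ratr e2) (ratr e3).
  case: fac => h2 h4 h6; split; rewrite /=.
  - transitivity (ratr (wa1 E ^+ 2 + 4%:R * wa2 E) : algC); first by ring.
    by rewrite h2; ring.
  - transitivity (ratr (2%:R * wa4 E + wa1 E * wa3 E) : algC); first by ring.
    by rewrite h4; ring.
  - transitivity (ratr (wa3 E ^+ 2 + 4%:R * wa6 E) : algC); first by ring.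
    by rewrite h6; ring.
have [x [y [eP prod0]]] := order4_x two_nz facC onP ord4; subst P.
have sigma_x := rational_order4_x stabC genC ord4.
(* An irrational square root x - e of a rational number would be negated by some sigma, but every
   sigma fixes x and e. *)
have rat_x (e q : rat) : (x - ratr e) ^+ 2 = ratr q -> exists q0 : rat, q0 ^+ 2 = q.
  move=> w2; have [/CratP[q0 eq0] | w_irr] := boolP (x - ratr e \in Crat).
    exists q0; apply: (fmorph_inj (ratr : {rmorphism rat -> algC})).
    by rewrite rmorphXn /= -eq0.
  have w_irrat q0 : x - ratr e <> ratr q0.
    by move=> eq0; case/negP: w_irr; rewrite eq0 Crat_rat.
  have [sigma] := aut_neg_sqrt w2 w_irrat.
  rewrite rmorphB /= sigma_x fmorph_rat => /eqP.
  rewrite -subr_eq0 opprK -mulr2n mulrn_eq0 /= => /eqP w0.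
  by case: (w_irrat 0); rewrite w0 rmorph0.
have rat2_nz : 2%:R != 0 :> rat by [].
move/eqP: prod0; rewrite !mulf_eq0 !subr_eq0 => /orP[/orP[]|] /eqP eq_sq.
- have [|q0 eq0] := rat_x e1 ((e1 - e2) * (e1 - e3)); first by rewrite eq_sq; ring.
  exact: factored_model rat2_nz fac disc eq0.
- have [|q0 eq0] := rat_x e2 ((e2 - e1) * (e2 - e3)); first by rewrite eq_sq; ring.
  apply: factored_model rat2_nz _ disc eq0.
  by case: fac; rewrite /factored => -> -> ->; split; ring.
- have [|q0 eq0] := rat_x e3 ((e3 - e1) * (e3 - e2)); first by rewrite eq_sq; ring.
  apply: factored_model rat2_nz _ disc eq0.
  by case: fac; rewrite /factored => -> -> ->; split; ring.
Qed.

(** * The polynomial g: its degree, its pencil and the independence of the differentials *)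

Section TwistPolynomial.
Variable a : rat.
Hypotheses (nz_a : a != 0) (a_neq1 : a - 1 != 0) (a_neqN1 : a + 1 != 0).
Let c := a ^+ 2 - 3%:R * a + 4%:R.

Lemma sqrD_pos_neq0 (x y : rat) : 0 < y -> x ^+ 2 + y != 0.
Proof. by move=> y_gt0; rewrite gt_eqF // ltr_wpDl ?sqr_ge0. Qed.

Let nz_c : c != 0.
Proof.
have : (a - 3%:R / 2%:R) ^+ 2 + 7%:R / 4%:R != 0.
  by apply: sqrD_pos_neq0; rewrite divr_gt0 ?ltr0n.
by congr (_ != 0); rewrite /c; field.
Qed.

Let nz_a2 : a ^+ 2 + 1 != 0. Proof. exact: sqrD_pos_neq0. Qed.

Let L1 : {poly rat} := ((a - 1) ^+ 2)%:P * 'X - a%:P.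
Let L2 : {poly rat} := (a ^+ 2 * c)%:P * 'X - ((a ^+ 2 + 1) * (a - 1))%:P.
Let Q1 : {poly rat} :=
  (a * c)%:P * 'X^2 - (2%:R * a * (a - 1))%:P * 'X + (a + 1)%:P.
Let Q2 : {poly rat} := (a * (a + 1) * (a - 1) ^+ 2 * c)%:P * 'X^2
  - (2%:R * a * (a - 1) ^+ 2 * (a ^+ 2 + 1))%:P * 'X + ((a ^+ 2 + 1) ^+ 2)%:P.
Let Q3 : {poly rat} := (a ^+ 2 * (a - 1) ^+ 2 * c ^+ 2)%:P * 'X^4
  - (4%:R * a ^+ 2 * (a - 1) ^+ 3 * c)%:P * 'X^3
  + (2%:R * (a - 1) ^+ 2
     * (3%:R * a ^+ 4 - 6%:R * a ^+ 3 + 5%:R * a ^+ 2 + 2%:R))%:P * 'X^2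
  - (4%:R * a * (a - 1) ^+ 2 * (a ^+ 2 + 1))%:P * 'X + ((a ^+ 2 + 1) ^+ 2)%:P.
(** Square roots of the members of the pencil spanned by A = ['X * L1 * L2] and B = [Q1 * Q2] that
    are a + 1 times a square. *)
Let S1 : {poly rat} := (a ^+ 2 + 1)%:P - (a * (a - 1) * c)%:P * 'X^2.
Let S2 : {poly rat} := (a * (a ^+ 2 + 1))%:P
  - (2%:R * (a ^+ 2 + 1) * (a - 1) ^+ 2)%:P * 'X + (a ^+ 2 * (a - 1) * c)%:P * 'X^2.
Let S3 : {poly rat} := ((a - 1) * (a ^+ 2 + 1))%:P
  - (2%:R * a ^+ 2 * c)%:P * 'X + (a * (a - 1) ^+ 2 * c)%:P * 'X^2.

Let twist_polyE b : twist_poly a b = - 4%:R * b%:P * ('X * L1 * L2) * (Q1 * Q2) * Q3.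
Proof.
rewrite /twist_poly -!mul_polyC -/c /L1 /L2 /Q1 /Q2 /Q3.
have -> : (- 4%:R * b)%:P = - 4%:R * b%:P :> {poly rat} by rewrite polyCM polyCN polyC_natr.
have regroup (k x l1 l2 q1 q2 q3 : {poly rat}) :
  k * x * l1 * l2 * q1 * q2 * q3 = k * (x * l1 * l2) * (q1 * q2) * q3 by ring.
exact: regroup.
Qed.

(** The degrees of the factors add up to 1 + 1 + 1 + 2 + 2 + 4 = 11, and their leading coefficients
    are products of powers of a, a - 1, a + 1 and c. *)
Lemma size_twist_poly b : b != 0 -> size (twist_poly a b) = 12%N.
Proof.
move=> nz_b; rewrite twist_polyE.
have sizeP n (p : {poly rat}) : p`_n != 0 -> (size p <= n.+1)%N -> size p = n.+1.
  move=> nz_p le_p; apply/eqP; rewrite eqn_leq le_p ltnNge.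
  by apply: contra nz_p => /leq_sizeP->.
have simp := (mulr0, mulr1, subr0, addr0).
have s1 : size L1 = 2.
  apply: sizeP; first by rewrite !coefE /= !simp expf_neq0.
  by apply/leq_sizeP => -[|[|j]] //; rewrite !coefE /= !simp.
have s2 : size L2 = 2.
  apply: sizeP; first by rewrite !coefE /= !simp mulf_neq0 ?expf_neq0.
  by apply/leq_sizeP => -[|[|j]] //; rewrite !coefE /= !simp.
have s3 : size Q1 = 3.
  apply: sizeP; first by rewrite !coefE /= !simp mulf_neq0.
  by apply/leq_sizeP => -[|[|[|j]]] //; rewrite !coefE /= !simp.
have s4 : size Q2 = 3.
  apply: sizeP; first by rewrite !coefE /= !simp !mulf_neq0 ?expf_neq0.
  by apply/leq_sizeP => -[|[|[|j]]] //; rewrite !coefE /= !simp.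
have s5 : size Q3 = 5.
  apply: sizeP; first by rewrite !coefE /= !simp !mulf_neq0 ?expf_neq0.
  by apply/leq_sizeP => -[|[|[|[|[|j]]]]] //; rewrite !coefE /= !simp.
have s0 : size (- 4%:R * b%:P : {poly rat}) = 1.
  by rewrite -polyC_natr -polyCN -polyCM size_polyC mulf_neq0.
have sizeM m n (p q : {poly rat}) :
    size p = m.+1 -> size q = n.+1 -> size (p * q) = (m + n).+1.
  move=> sp sq; have nz_p : p != 0 by rewrite -size_poly_gt0 sp.
  have nz_q : q != 0 by rewrite -size_poly_gt0 sq.
  by rewrite size_mul // sp sq addSn addnS.
exact: (sizeM _ _ _ _ (sizeM _ _ _ _ (sizeM _ _ _ _ s0
  (sizeM _ _ _ _ (sizeM _ _ _ _ (size_polyX _) s1) s2)) (sizeM _ _ _ _ s3 s4)) s5).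
Qed.

(** The constant and the quartic coefficient of the combination give two equations whose sum forces
    n0 = 0; the first then expresses n2 by n1, and the coefficient of u forces n1 = 0. *)
Lemma free_squares (n0 n1 n2 : rat) :
  n0%:P * (S2 * S3) + n1%:P * (S1 * S3) - 2%:R * n2%:P * (S1 * S2) = 0 ->
  [/\ n0 = 0, n1 = 0 & n2 = 0].
Proof.
set P := (X in X = 0) => P0.
pose s1 (u : rat) := (a ^+ 2 + 1) - (a * (a - 1) * c) * u ^+ 2.
pose s2 (u : rat) := (a * (a ^+ 2 + 1))
  - (2%:R * (a ^+ 2 + 1) * (a - 1) ^+ 2) * u + (a ^+ 2 * (a - 1) * c) * u ^+ 2.
pose s3 (u : rat) := ((a - 1) * (a ^+ 2 + 1))
  - (2%:R * a ^+ 2 * c) * u + (a * (a - 1) ^+ 2 * c) * u ^+ 2.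
pose h u := n0 * (s2 u * s3 u) + n1 * (s1 u * s3 u) - 2%:R * n2 * (s1 u * s2 u).
have h0 u : h u = 0.
  transitivity P.[u]; last by rewrite P0 horner0.
  have hornerP (T1 T2 T3 : {poly rat}) :
      (n0%:P * (T2 * T3) + n1%:P * (T1 * T3) - 2%:R * n2%:P * (T1 * T2)).[u]
      = n0 * (T2.[u] * T3.[u]) + n1 * (T1.[u] * T3.[u]) - 2%:R * n2 * (T1.[u] * T2.[u]).
    by rewrite -polyC_natr !(hornerD, hornerN, hornerM, hornerC).
  have e1 : S1.[u] = s1 u by rewrite /S1 !(hornerD, hornerN, hornerCM, hornerXn, hornerC).
  have e2 : S2.[u] = s2 u.
    by rewrite /S2 !(hornerD, hornerN, hornerCM, hornerXn, hornerX, hornerC).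
  have e3 : S3.[u] = s3 u.
    by rewrite /S3 !(hornerD, hornerN, hornerCM, hornerXn, hornerX, hornerC).
  by rewrite /P hornerP e1 e2 e3.
have eq0 : n0 * a * (a - 1) + n1 * (a - 1) - 2%:R * n2 * a = 0.
  apply: (mulfI (expf_neq0 2 nz_a2)); rewrite mulr0 -[RHS](h0 0).
  by rewrite /h /s1 /s2 /s3; ring.
have eq4 : n0 * a * (a - 1) - n1 * (a - 1) + 2%:R * n2 * a = 0.
  have nz_p : 24%:R * (a * (a - 1) * c) ^+ 2 != 0 by rewrite mulf_neq0 ?expf_neq0 ?mulf_neq0.
  apply: (mulfI nz_p); rewrite mulr0.
  (* Fourth difference, 24 times the coefficient of u^4. *)
  transitivity (h 2%:R + h (- 2%:R) - 4%:R * (h 1 + h (- 1)) + 6%:R * h 0).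
    by rewrite /h /s1 /s2 /s3; ring.
  by rewrite !h0; ring.
have n00 : n0 = 0.
  have nz_p : 2%:R * a * (a - 1) != 0 by rewrite !mulf_neq0.
  apply: (mulfI nz_p); rewrite mulr0 -[RHS](addr0 0) -{1}eq0 -eq4; ring.
have n2E : 2%:R * n2 = n1 * (a - 1) / a.
  apply: (mulIf nz_a); rewrite divfK //; move: eq0; rewrite n00 !mul0r add0r.
  by move/eqP; rewrite subr_eq0 => /eqP.
have n10 : n1 = 0.
  (* The square completes 4a^2 - 3a + 1 = a^3 c - (a^2+1)(a-1)^3. *)
  have nz_q : (2%:R * a - 3%:R / 4%:R) ^+ 2 + 7%:R / 16%:R != 0.
    by apply: sqrD_pos_neq0; rewrite divr_gt0 ?ltr0n.
  have nz_p : 24%:R * (a ^+ 2 + 1) * ((2%:R * a - 3%:R / 4%:R) ^+ 2 + 7%:R / 16%:R) / a != 0.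
    by rewrite !mulf_neq0 ?invr_neq0.
  apply: (mulfI nz_p); rewrite mulr0.
  (* 12 times the coefficient of u, up to sign. *)
  transitivity (- (8%:R * (h 1 - h (- 1)) - (h 2%:R - h (- 2%:R)))); last by rewrite !h0; ring.
  by rewrite /h /s1 /s2 /s3 n00 n2E /c; field.
split=> //; apply: (mulfI (_ : 2%:R != 0 :> rat)) => //.
by rewrite n2E n10 !mul0r mulr0.
Qed.

Lemma twist_poly_rank b : b != 0 ->
  rank_at_least (tofrac (twist_poly a b)) (map_weierstrass Qu_const (model a b)) 3.
Proof.
move=> nz_b; rewrite twist_polyE.
(* As u divides A, the Wronskian at 0 is -B(0) (A/u)(0), a product of powers of a, a - 1, a + 1 and
   a^2 + 1 up to sign. *)
have nonconst : (Q1 * Q2)^`() * ('X * L1 * L2) - Q1 * Q2 * ('X * L1 * L2)^`() != 0.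
  apply/negP=> /eqP /(congr1 (fun p : {poly rat} => p.[0])) /eqP; apply/negP.
  have wronskian0 (p r : {poly rat}) :
      (p^`() * ('X * r) - p * ('X * r)^`()).[0] = - (p.[0] * r.[0]).
    by rewrite derivM derivX !(hornerD, hornerN, hornerM, hornerX, hornerC); ring.
  have q1 : Q1.[0] = a + 1.
    by rewrite /Q1 !(hornerD, hornerN, hornerCM, hornerXn, hornerX, hornerC); ring.
  have q2 : Q2.[0] = (a ^+ 2 + 1) ^+ 2.
    by rewrite /Q2 !(hornerD, hornerN, hornerCM, hornerXn, hornerX, hornerC); ring.
  have l1 : L1.[0] = - a.
    by rewrite /L1 !(hornerD, hornerN, hornerCM, hornerX, hornerC); ring.
  have l2 : L2.[0] = - ((a ^+ 2 + 1) * (a - 1)).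
    by rewrite /L2 !(hornerD, hornerN, hornerCM, hornerX, hornerC); ring.
  rewrite -(mulrA 'X L1 L2) wronskian0 (hornerM Q1 Q2) (hornerM L1 L2) q1 q2 l1 l2 horner0.
  by rewrite oppr_eq0; do ?apply: mulf_neq0; rewrite ?oppr_eq0 ?expf_neq0 ?mulf_neq0.
apply: (twist_rank3_poly (S1 := S1) (S2 := S2) (S3 := S3)) => //.
- by rewrite /L1 /L2 /Q1 /Q2 /Q3 /c; ring.
- by rewrite /L1 /L2 /Q1 /Q2 /S1 /c; ring.
- by rewrite /L1 /L2 /Q1 /Q2 /S2 /c; ring.
- by rewrite /L1 /L2 /Q1 /Q2 /S3 /c; ring.
- by apply: contraNneq nonconst => ->; rewrite derivC !mulr0 subrr.
move=> m eq0.
have [|m0 m1 m2] := @free_squares (m 0)%:~R (m 1)%:~R (m 2)%:~R.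
  by rewrite !rmorph_int.
case=> [[|[|[|//]]] lt_i]; apply/eqP; rewrite -(intr_eq0 rat); apply/eqP.
- by rewrite -[RHS]m0; congr (m _)%:~R; apply: val_inj.
- by rewrite -[RHS]m1; congr (m _)%:~R; apply: val_inj.
- by rewrite -[RHS]m2; congr (m _)%:~R; apply: val_inj.
Qed.
End TwistPolynomial.

Unset Implicit Arguments.

Theorem theorem4p3 (E : weierstrass rat) (E_elliptic : discriminant E != 0)
    (E_2torsion : full_rational_2torsion E)
    (E_cyclic4 : has_rational_cyclic_subgroup E 4) :
  (exists a b : rat,
     [/\ a != 0, b != 0, a != 1 & isomorphic E (model a b)])
  /\
  (forall a b : rat,
     a != 0 -> b != 0 -> a != 1 -> isomorphic E (model a b) ->
     size (twist_poly a b) = 12%N (* i.e. degree 11 *) /\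
     rank_at_least (tofrac (twist_poly a b))
       (map_weierstrass Qu_const (model a b)) 3).
Proof.
split; first exact: exists_model.
move=> a b nz_a nz_b a_neq1 /isomorphic_discriminant[u _ disc].
have a1 : a - 1 != 0 by rewrite subr_eq0.
(* The discriminant of the model contains (a^2 - 1)^2, so a = -1 would make E singular. *)
have aN1 : a + 1 != 0.
  apply: contraNneq E_elliptic => /eqP; rewrite addr_eq0 => /eqP aE.
  by rewrite disc model_discriminant aE sqrrN expr1n subrr expr0n !mulr0.
by split; [apply: size_twist_poly | apply: twist_poly_rank].
Qed.
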